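(* Assume that $2^{<\mathfrak{c}} = \mathfrak{c}$ and, moreover, that every strongly separated space of cardinality $\mathfrak{c}$ has an uncountable discrete subspace. Then: (1) every Hausdorff space of countable spread has cardinality $\le \mathfrak{c}$; (2) for every infinite regular space $X$ of countable spread we have $o(X) = \mathfrak{c}$.
   Context: ''Space'' always means an infinite Hausdorff topological space (so regular spaces are Hausdorff). $\mathfrak{c}=2^{\aleph_0}$ and $2^{<\mathfrak{c}}=\sup\{2^\lambda : \lambda<\mathfrak{c}\}$. A space has countable spread if it has no uncountable discrete subspace. $o(X)$ is the number of all open subsets of $X$. A space $X$ is strongly left separated (resp. strongly right separated) if it has a well-ordering $\prec$ such that every point $x\in X$ has a closed neighborhood $W_x$ such that $y\notin W_x$ whenever $y\prec x$ (resp. whenever $x\prec y$). $X$ is strongly separated if it is strongly left separated or strongly right separated. *)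

(* Defs.v *)
From mathcomp Require Import all_boot.
From mathcomp Require Import all_classical topology.
From mathcomp Require Import wochoice.

Set Implicit Arguments.
Unset Strict Implicit.
Unset Printing Implicit Defensive.

Local Open Scope classical_set_scope.
Local Open Scope card_scope.

(* Cardinals are represented by sets, compared with #<= and #=. *)

Definition continuum : set (set nat) := [set: set nat].

Definition card_lt (T U : Type) (A : set T) (B : set U) : Prop :=
  A #<= B /\ ~ (B #<= A).

(* S has cardinality 2^{<K}, the least upper bound of the 2^L with L < K;
   2^L is the cardinality of the power set of L. *)
Definition has_card_two_pow_lt (T U : Type) (S : set T) (K : set U) : Prop :=
  (forall L : Type, card_lt [set: L] K -> [set: set L] #<= S) /\
  (forall (V : Type) (B : set V),
     (forall L : Type, card_lt [set: L] K -> [set: set L] #<= B) -> S #<= B).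

(* The topology on the type set_type D is the one induced by X. *)
Definition discrete_subspace (X : topologicalType) (D : set X) : Prop :=
  forall A : set (set_type D), open A.

Definition has_uncountable_discrete_subspace (X : topologicalType) : Prop :=
  exists D : set X, discrete_subspace D /\ ~ countable D.

Definition countable_spread (X : topologicalType) : Prop :=
  ~ has_uncountable_discrete_subspace X.

(* well_order is about reflexive relations, so the strict order is
   "R y x and y <> x". *)
Definition strongly_left_separated (X : topologicalType) : Prop :=
  exists2 R : rel X, well_order R &
    forall x : X, exists W : set X,
      [/\ closed W, nbhs x W & forall y : X, R y x -> y <> x -> ~ W y].

Definition strongly_right_separated (X : topologicalType) : Prop :=
  exists2 R : rel X, well_order R &
    forall x : X, exists W : set X,
      [/\ closed W, nbhs x W & forall y : X, R x y -> x <> y -> ~ W y].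

Definition strongly_separated (X : topologicalType) : Prop :=
  strongly_left_separated X \/ strongly_right_separated X.

(* Main.v *)
Require Import Defs.
From mathcomp Require Import all_boot.
From mathcomp Require Import all_classical topology.
From mathcomp Require Import wochoice.

(** Write c for the continuum and fix a well-order of c all of whose proper
    initial segments have fewer than c elements; by 2^{<c} = c, such a segment
    has at most c subsets.

    The separation hypothesis turns into two covering properties of a Hausdorff
    space X of countable spread. Suppose that every point y of a set Y has a
    closed neighbourhood W y and that Y is not covered by fewer than c of the
    sets W y. Then points of Y can be chosen along c, each outside the W y of
    the earlier ones. They form a strongly right separated space of size c,
    which has an uncountable discrete subspace, and then so does X: a
    contradiction ([small_cover]). If X is regular and no set of fewer than c
    points is dense, points can be chosen along c, each outside the closure of
    the earlier ones, and X contains a strongly left separated space of size c,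
    which is again absurd ([small_dense]).

    (1) Given a point p, give every y <> p a closed neighbourhood missing p.
    Fewer than c of them cover the complement of p, so p is the intersection of
    fewer than c open sets ([small_pseudocharacter]). The index sets of these
    intersections are segments of c, of which there are only c, so it is enough
    to bound the set of points p for which the index set is one given segment K.
    Colour each pair of such points by the two members of K whose open sets
    separate one point from the other. A homogeneous set is discrete, hence
    countable; as K x K has at most c subsets, the partition theorem of Erdos
    and Rado ([erdos_rado]) leaves room for at most c points.

    (2) Let D be a dense set of fewer than c points. By regularity every open
    set is a union of interiors of closures of subsets of D, and fewer than c of
    them suffice by [small_cover] again. So an open set is coded by a segment K
    of c and a subset of K x D, which leaves at most c open sets. Conversely, an
    infinite Hausdorff space has infinitely many disjoint nonempty open sets,
    whose unions are c distinct open sets. *)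

Set Implicit Arguments.
Unset Strict Implicit.
Unset Printing Implicit Defensive.

Local Open Scope classical_set_scope.
Local Open Scope card_scope.

(** * Sets of cardinality at most the continuum *)

Lemma card_le_continuumP (T : Type) (A : set T) :
  A #<= continuum <-> exists f : T -> set nat, {in A &, injective f}.
Proof. by split=> /pcard_injP. Qed.

Lemma type_le_continuumP (T : Type) :
  [set: T] #<= continuum <-> exists f : T -> set nat, injective f.
Proof.
rewrite card_le_continuumP; split=> -[f fI]; exists f; last exact: in2W.
by move=> x y; apply: fI; rewrite inE.
Qed.

(** Bounding the power set of K, rather than K itself, gives a class of index
    types that is closed under products without any appeal to K x K being
    equinumerous to K. *)
Definition pow_le_continuum (K : Type) : Prop := [set: set K] #<= continuum.

Lemma pow_le_continuum_nat : pow_le_continuum nat.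
Proof. exact: card_lexx. Qed.

(** As functions from L to subsets of nat are the same as functions from nat to
    subsets of L, the chain is
    2^(K x L) = (2^K)^L <= (2^nat)^L = (2^L)^nat <= (2^nat)^nat = 2^nat. *)
Lemma pow_le_continuumX (K L : Type) :
  pow_le_continuum K -> pow_le_continuum L -> pow_le_continuum (K * L).
Proof.
move=> /type_le_continuumP[f fI] /type_le_continuumP[g gI].
apply/type_le_continuumP.
pose F (S : set (K * L)) : set nat := [set p | if unpickle p is Some (n, m)
  then g [set l | f [set k | S (k, l)] n] m else False].
exists F => S S' eqF; apply/funext => -[k l]; apply/propext.
suff /fI/seteqP[sub1 sub2] : f [set k | S (k, l)] = f [set k | S' (k, l)].
  by split=> ?; [apply: (sub1 k)|apply: (sub2 k)].
apply/funext => n; apply/propext.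
suff /gI/seteqP[sub1 sub2] : g [set l | f [set k | S (k, l)] n] =
    g [set l | f [set k | S' (k, l)] n].
  by split=> ?; [apply: (sub1 l)|apply: (sub2 l)].
apply/funext => m; have := congr1 (@^~ (pickle (n, m))) eqF.
by rewrite /F /= pickleK.
Qed.

(** A point is coded by the index of a member containing it, stored on the odd
    numbers, and by its code in that member, stored on the even ones. *)
Lemma card_bigcup_le_continuum (T : Type) (F : set nat -> set T) :
  (forall a, F a #<= continuum) -> \bigcup_a F a #<= continuum.
Proof.
move=> leF; have /choice[f fI] : forall a, exists f : T -> set nat,
    {in F a &, injective f} by move=> a; apply/card_le_continuumP.
have /choice[s sP] : forall x, exists a, (\bigcup_a F a) x -> F a x.
  move=> x; have [[a _ Fax]|nF] := pselect ((\bigcup_a F a) x).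
    by exists a.
  by exists set0.
apply/card_le_continuumP.
exists (fun x => [set n | if odd n then s x n./2 else f (s x) x n./2]).
move=> x y; rewrite !inE => /sP sx /sP sy eqxy.
have sxy : s x = s y.
  apply/funext => n; have := congr1 (@^~ n.*2.+1) eqxy.
  by rewrite /= odd_double /= uphalf_double.
apply: (fI (s x)); rewrite ?inE //; first by rewrite sxy.
apply/funext => n; have := congr1 (@^~ n.*2) eqxy.
by rewrite /= odd_double /= doubleK sxy.
Qed.

(** * Well-orders and transfinite selection *)

Section WellOrder.
Variables (T : eqType) (R : rel T).
Hypothesis woR : well_order R.

Let woC : wo_chain R predT. Proof. exact: withinW. Qed.

Lemma wo_total x y : R x y || R y x.
Proof. exact: (wo_chainW woC). Qed.

Lemma wo_anti x y : R x y -> R y x -> x = y.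
Proof.
by move=> xy yx; apply: (wo_chain_antisymmetric woC) => //; rewrite xy.
Qed.

Lemma wo_least (A : set T) :
  A !=set0 -> exists2 z, A z & forall x, A x -> R z x.
Proof.
case=> a Aa; have [|z [[Az leA] _]] := @woR (mem A).
  by exists a; apply/mem_set.
by exists z; [exact/set_mem|move=> x Ax; apply/leA/mem_set].
Qed.

Lemma wo_trans x y z : R x y -> R y z -> R x z.
Proof.
move=> xy yz; have [|w Aw leA] := @wo_least [set x; y; z].
  by exists x; left; left.
have wx : R w x by apply: leA; left; left.
have wy : R w y by apply: leA; left; right.
have wz : R w z by apply: leA; right.
case: Aw => [[|]|] eqw; rewrite eqw in wx wy wz => //.
- by rewrite (wo_anti xy wx).
- by rewrite -(wo_anti yz wy).
Qed.

Definition wo_lt : rel T := fun x y => R x y && (x != y).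

Lemma wo_lt_irr x : wo_lt x x = false.
Proof. by rewrite /wo_lt eqxx andbF. Qed.

Lemma wo_le_ltF x y : R x y -> wo_lt y x -> False.
Proof. by move=> xy /andP[yx /eqP]; apply; apply: wo_anti. Qed.

Lemma wo_ltgt x y : x <> y -> wo_lt x y \/ wo_lt y x.
Proof.
move=> /eqP nxy; rewrite /wo_lt (eq_sym y) nxy !andbT.
exact/orP/wo_total.
Qed.

Lemma wo_lt_trans x y z : wo_lt x y -> wo_lt y z -> wo_lt x z.
Proof.
move=> /andP[xy nxy] yz; have /andP[leyz _] := yz.
rewrite /wo_lt (wo_trans xy leyz); apply/eqP => eqxz.
by apply: (@wo_le_ltF x y) => //; rewrite eqxz.
Qed.

Lemma wo_lt_wf : well_founded wo_lt.
Proof.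
move=> x; apply: contrapT => nAx.
have [|z nAz leA] := @wo_least [set x | ~ Acc wo_lt x]; first by exists x.
apply: nAz; constructor => y ltyz; apply: contrapT => /leA zy.
exact: wo_le_ltF ltyz.
Qed.

(** Recursion with a non-dependent step: [F] receives a total function but may
    look at it only below its argument, so that [g] satisfies a plain
    equation. *)
Lemma wf_recursion (B : Type) (b0 : B) (F : T -> (T -> B) -> B) :
  (forall x g g', (forall y, wo_lt y x -> g y = g' y) -> F x g = F x g') ->
  exists g : T -> B, forall x, g x = F x g.
Proof.
move=> Floc.
pose G x (rec : forall y, wo_lt y x -> B) : B :=
  F x (fun y => if pselect (wo_lt y x) is left lt then rec y lt else b0).
exists (Fix wo_lt_wf (fun=> B) G) => x; rewrite Fix_eq; last first.
  move=> {}x r r' eqr; apply: Floc => y _; case: pselect => // ?; exact: eqr.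
by apply: Floc => y ltyx; case: pselect.
Qed.

End WellOrder.

Definition segment (R : rel (set nat)) (a : set nat) : Type :=
  {b : set nat | wo_lt R b a}.

(** In any well-order of the continuum, either all segments are small already,
    or the least segment that is not small is equinumerous to the continuum
    while its own segments are small: its order is pulled back along [g]. *)
Lemma initial_well_order_continuum : exists2 R : rel (set nat), well_order R &
  forall a, card_lt [set: segment R a] continuum.
Proof.
have [R0 woR0] := well_ordering_principle (set nat).
suff [g gI gseg] : exists2 g : set nat -> set nat, injective g &
    forall x, ~ exists j : set nat -> segment R0 (g x), injective j.
  exists (fun x y => R0 (g x) (g y)).
    apply: antisymmetric_well_order => [x y /andP[xy yx]|A [a Aa]].
      exact/gI/(wo_anti woR0).
    have [|_ [z Az <-] leA] := @wo_least _ R0 woR0 [set g x | x in A].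
      by exists (g a), a.
    by exists z; split=> // x xA; apply: leA; exists x.
  move=> a; split.
    by apply/type_le_continuumP; exists val; exact: val_inj.
  have seg0 (b : segment (fun x y => R0 (g x) (g y)) a) :
      wo_lt R0 (g (val b)) (g a).
    by case: b => b /= /andP[? ?]; rewrite /wo_lt (inj_eq gI); apply/andP.
  move=> /card_leP[j]; apply: (gseg a).
  pose k x := j (SigSub (mem_set (I : [set: set nat] x))).
  exists (fun x => exist (fun b => wo_lt R0 b (g a)) (g (val (val (k x))))
    (seg0 _)) => x y.
  move=> /(congr1 val) /= /gI /val_inj /val_inj.
  by move=> /(inj (mem_set I) (mem_set I)) /(congr1 val).
have [nex|/contrapT ex] := pselect
    (~ exists x, exists j : set nat -> segment R0 x, injective j).
  by exists id => // x ?; apply: nex; exists x.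
have [m [j jI] leA] := wo_least woR0 ex.
exists (val \o j) => [|x exj]; first by move=> x y /val_inj /jI.
have := leA _ exj; move/(wo_le_ltF woR0); apply; exact: (valP (j x)).
Qed.

(** Choose a point acceptable after the earlier ones as long as there is one.
    The choice succeeds all along the continuum unless some family indexed by a
    segment admits no acceptable point. *)
Lemma transfinite_selection (R : rel (set nat)) (T : Type) (t0 : T)
    (P : set T -> T -> Prop) : well_order R ->
  (exists g : set nat -> T,
     forall a, P (range (fun b : segment R a => g (val b))) (g a)) \/
  (exists a, exists h : segment R a -> T, forall t, ~ P (range h) t).
Proof.
move=> woR.
have /choice[s sP] : forall A, exists t, (exists t', P A t') -> P A t.
  move=> A; have [[t Pt]|nex] := pselect (exists t, P A t); first by exists t.
  by exists t0.
pose F a (g : set nat -> T) := s (range (fun b : segment R a => g (val b))).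
have Floc a g g' : (forall b, wo_lt R b a -> g b = g' b) -> F a g = F a g'.
  move=> eqg; rewrite /F; suff -> : (fun b : segment R a => g (val b)) =
    (fun b => g' (val b)) by [].
  by apply/funext => b; exact: (eqg _ (valP b)).
have [g gE] := wf_recursion woR t0 Floc.
have [Pg|/existsNP[a nPa]] := pselect
    (forall a, P (range (fun b : segment R a => g (val b))) (g a)).
  by left; exists g.
right; exists a, (fun b => g (val b)) => t Pt; apply: nPa.
by rewrite [X in P _ X]gE; apply: sP; exists t.
Qed.

(** * The Erdos-Rado partition theorem *)

Section ErdosRado.
Variables (T : choiceType) (R : rel T) (K : Type) (f : T -> T -> K).
Hypothesis woR : well_order R.

(** The Erdos-Rado tree: u is a predecessor of x when u comes before x and is
    not distinguished from x by the colours it has with its own predecessors.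
    The predecessors of x form an end-homogeneous chain. *)
Lemma tree_order_exists : exists pred : T -> set T, forall x,
  pred x = [set u | wo_lt R u x /\ forall w, pred u w -> f w u = f w x].
Proof.
apply: (@wf_recursion _ R woR _ set0 (fun x p =>
  [set u | wo_lt R u x /\ forall w, p u w -> f w u = f w x])).
move=> x p p' eqp; apply/seteqP; split=> u /= [ux eqf]; split=> // w.
  by rewrite -eqp //; exact: eqf.
by rewrite eqp //; exact: eqf.
Qed.

Variable pred : T -> set T.
Hypothesis predE : forall x,
  pred x = [set u | wo_lt R u x /\ forall w, pred u w -> f w u = f w x].

Lemma pred_lt x u : pred x u -> wo_lt R u x.
Proof. by rewrite predE => -[]. Qed.

Lemma pred_color x u w : pred x u -> pred u w -> f w u = f w x.
Proof. by rewrite predE => -[_]; exact. Qed.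

Lemma pred_trans x u w : pred x u -> pred u w -> pred x w.
Proof.
elim/(well_founded_ind (wo_lt_wf woR)): w x u => w IH x u xu uw.
rewrite predE; split; first exact: (wo_lt_trans woR) (pred_lt uw) (pred_lt xu).
move=> t wt; have ut : pred u t := IH t (pred_lt wt) u w uw wt.
by rewrite (pred_color uw wt) (pred_color xu ut).
Qed.

Lemma pred_chain x u v : pred x u -> pred x v -> wo_lt R u v -> pred v u.
Proof.
elim/(well_founded_ind (wo_lt_wf woR)): u => u IH xu xv uv.
rewrite predE; split=> // w uw; have ltwu := pred_lt uw.
have vw : pred v w.
  by apply: IH => //; [exact: pred_trans uw|exact: (wo_lt_trans woR) uv].
by rewrite (pred_color xu uw) (pred_color xv vw).
Qed.

(** If two distinct points had the same predecessors with the same colours, the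
    smaller one would be a predecessor of the larger one, hence of itself. *)
Lemma pred_ext x y : pred x = pred y ->
  (forall w, pred x w -> f w x = f w y) -> x = y.
Proof.
move=> eqp eqf; apply: contrapT => /(wo_ltgt woR)[lt|lt].
  have : pred y x by rewrite predE; split.
  by rewrite -eqp => /pred_lt; rewrite wo_lt_irr.
have : pred x y by rewrite predE; split=> // w; rewrite -eqp => /eqf.
by rewrite eqp => /pred_lt; rewrite wo_lt_irr.
Qed.

End ErdosRado.

(** Among the predecessors u of x, those with a given colour f u x form a
    homogeneous set, so they can be numbered. This embeds the predecessors of x
    in K x nat, and x is determined by the image of the tree order under this
    embedding: by induction along the tree, two points with the same image have
    the same predecessors, with the same colours. There are at most as many
    images as subsets of (K x nat) x (K x nat). *)
Lemma erdos_rado (T : choiceType) (R : rel T) (K : Type) (f : T -> T -> K) :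
  well_order R -> pow_le_continuum K ->
  (forall (H : set T) (k : K),
    (forall x y, H x -> H y -> wo_lt R x y -> f x y = k) -> countable H) ->
  [set: T] #<= continuum.
Proof.
move=> woR Ksmall ctbl; have [pred predE] := tree_order_exists f woR.
have plt := pred_lt predE; have pcol := pred_color predE.
have ptr := pred_trans woR predE.
have pext := pred_ext woR predE.
have chain x u v : pred x u -> pred x v -> wo_lt R u v -> f u v = f u x.
  move=> xu xv uv; apply: (pcol _ _ _ xv).
  exact: (pred_chain woR predE xu xv uv).
have /choice[n nP] : forall x, exists n : T -> nat, forall u v,
    pred x u -> pred x v -> f u x = f v x -> n u = n v -> u = v.
  move=> x; have /choice[g gI] : forall k, exists g : T -> nat,
      {in [set u | pred x u /\ f u x = k] &, injective g}.
    move=> k; apply/countable_injP.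
    apply: (ctbl _ k) => u v /= [xu fu] [xv fv] uv.
    by rewrite (chain x).
  exists (fun u => g (f u x) u) => u v xu xv fuv; rewrite fuv.
  by apply: gI; rewrite inE.
pose e x u : K * nat := (f u x, n x u).
have eI x u v : pred x u -> pred x v -> e x u = e x v -> u = v.
  by move=> xu xv [fuv nuv]; exact: nP nuv.
(* The disjunct u = v records also the predecessors that are related to no
   other one. *)
pose code x : set ((K * nat) * (K * nat)) :=
  [set p | exists u v, [/\ pred x v, u = v \/ pred v u & p = (e x u, e x v)]].
have Msmall := pow_le_continuumX Ksmall pow_le_continuum_nat.
have /type_le_continuumP[c cI] := pow_le_continuumX Msmall Msmall.
(* A predecessor of u is visible in the code of x through the pair it forms
   with u; the same pair, read in the code of y, is a predecessor of v. *)
have code_pred x y u v w : code x = code y -> pred x u -> pred y v ->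
    e x u = e y v -> pred u w -> exists2 w', pred v w' & e x w = e y w'.
  move=> eqc xu yv exy uw.
  have : code x (e x w, e x u) by exists w, u; split=> //; right.
  rewrite eqc => -[w' [v' [yv' eqw' /pair_equal_spec[eqw equ]]]].
  have {}equ : v' = v by apply: (eI y); rewrite // -equ.
  subst v'; case: eqw' => [eqw'|]; last by exists w'.
  subst w'; have /plt : pred u u.
    by rewrite -{2}(eI x w u (ptr _ _ _ xu uw) xu) // eqw exy.
  by rewrite wo_lt_irr.
(* If u and v occupy the same place in equal codes, so do their predecessors,
   which are equal by induction; [pext] concludes. *)
have code_inj x y : code x = code y -> forall u v, pred x u -> pred y v ->
    e x u = e y v -> u = v.
  move=> eqc; elim/(well_founded_ind (wo_lt_wf woR)) => u IH v xu yv exy.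
  have ww' w : pred u w -> pred v w /\ e x w = e y w.
    move=> uw; have [w' vw' eqw] := code_pred _ _ _ _ _ eqc xu yv exy uw.
    have eqww' : w = w'.
      apply: (IH w (plt _ _ uw) w') => //; first exact: (ptr _ _ _ xu uw).
      exact: (ptr _ _ _ yv vw').
    by subst w'.
  apply: pext.
    apply/seteqP; split=> w; first by case/ww'.
    move=> vw; have [w' uw' eqw] :=
      code_pred _ _ _ _ _ (esym eqc) yv xu (esym exy) vw.
    have -> // : w = w'.
    apply/esym/(IH w' (plt _ _ uw') w) => //; first exact: (ptr _ _ _ xu uw').
    exact: (ptr _ _ _ yv vw).
  move=> w uw; rewrite (pcol _ _ _ xu uw); have [vw [-> _]] := ww' _ uw.
  by rewrite (pcol _ _ _ yv vw).
have code_sub x y w : code x = code y -> pred x w -> pred y w /\ e x w = e y w.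
  move=> eqc xw; have : code x (e x w, e x w) by exists w, w; split=> //; left.
  rewrite eqc => -[_ [w' [yw' _ /pair_equal_spec[_ eqw]]]].
  by have eqww' := code_inj _ _ eqc _ _ xw yw' eqw; subst w'.
apply/type_le_continuumP; exists (c \o code) => x y /cI eqc; apply: pext.
  apply/seteqP; split=> w xw; first by have [] := code_sub _ _ _ eqc xw.
  by have [] := code_sub _ _ _ (esym eqc) xw.
by move=> w xw; have [_ [->]] := code_sub _ _ _ eqc xw.
Qed.

(** * Separation and discrete subspaces *)

Lemma hausdorff_separate (X : topologicalType) (x y : X) :
  hausdorff_space X -> x <> y ->
  exists U V, [/\ open U, open V, U x, V y & U `&` V = set0].
Proof.
rewrite open_hausdorff => hX /eqP /hX[[U V] /= [/set_mem Ux /set_mem Vy]].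
by case=> oU oV /eqP UV; exists U, V.
Qed.

Lemma regular_closed_nbhs (X : topologicalType) (x : X) (U : set X) :
  regular_space X -> open U -> U x ->
  exists W, [/\ closed W, nbhs x W & W `<=` U].
Proof.
move=> rX oU Ux; have [V Vx VU] := rX x U (open_nbhs_nbhs (conj oU Ux)).
exists (closure V); split=> //; first exact: closed_closure.
exact: filterS (@subset_closure _ V) Vx.
Qed.

Lemma discrete_subspaceP (X : topologicalType) (D : set X) :
  discrete_subspace D <->
  forall x, D x -> exists U, [/\ open U, U x & forall y, D y -> U y -> y = x].
Proof.
split=> [dD x Dx|dD A].
  pose x' : set_type D := SigSub (mem_set Dx).
  have [U oU UA] := dD [set x'].
  have : [set x'] x' by [].
  rewrite -UA => Ux; exists U; split=> // y Dy Uy.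
  have : [set x'] (SigSub (mem_set Dy)) by rewrite -UA.
  by move=> /(congr1 val).
have /choice[U UP] : forall x : set_type D, exists U,
    [/\ open U, U (val x) & forall y, D y -> U y -> y = val x].
  by move=> x; apply: dD; exact: set_valP.
exists (\bigcup_(x in A) U x).
  by apply: bigcup_open => x _; case: (UP x).
apply/seteqP; split=> x; last by move=> Ax; exists x => //; case: (UP x).
case=> y Ay Uyx; have [_ _ /(_ _ (set_valP x) Uyx)] := UP y.
by move=> /val_inj ->.
Qed.

(** Take the trace S of the interior of a closed neighbourhood of y inside U: by
    density the closure of S contains that interior, and it stays inside U. *)
Lemma regular_open_trace (X : topologicalType) (K : Type) (d : K -> X)
    (U : set X) (y : X) :
  regular_space X -> (forall x, closure (range d) x) -> open U -> U y ->
  exists S, closure (d @` S) `<=` U /\ (closure (d @` S))° y.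
Proof.
move=> rX dd oU Uy; have [W [cW nW WU]] := regular_closed_nbhs rX oU Uy.
exists [set k | W° (d k)]; split.
  apply: subset_trans WU; rewrite [X in _ `<=` X](closure_id W).1 //.
  by apply: closureS => _ [k Wk <-]; exact: interior_subset.
suff sub : W° `<=` closure (d @` [set k | W° (d k)]).
  by rewrite (open_subsetE _ (@open_interior _ W)) in sub; exact: sub.
move=> x Wx V Vx; have [] := dd x (V `&` W°).
  by apply: filterI => //; exact: nbhs_interior.
by move=> _ [[k _ <-] [Vk Wk]]; exists (d k); split=> //; exists k.
Qed.

(** A pair p, q is coloured by (i, j) where V p i misses q and V q j misses p.
    In a homogeneous set of colour (i, j), every other point q is missed by
    V p i if it comes after p and by V p j if it comes before, so the
    intersection of these two neighbourhoods isolates p. *)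
Lemma card_le_of_pseudocharacter (X : topologicalType) (K : Type) (Y : set X)
    (V : X -> K -> set X) : pow_le_continuum K -> countable_spread X ->
  (forall p k, Y p -> open (V p k) /\ V p k p) ->
  (forall p q, Y p -> p <> q -> exists k, ~ V p k q) ->
  Y #<= continuum.
Proof.
move=> Ksmall sX Vnbhs Vsep.
have [[k0]|nK] := pselect (inhabited K); last first.
  (* Without indices no two points are separated, so Y has at most one. *)
  apply/card_le_continuumP; exists (fun=> set0) => p q /set_mem Yp _ _.
  by apply: contrapT => /(Vsep _ _ Yp)[k _]; apply: nK; exists.
have /choice[s sP] : forall pq : X * X, exists k,
    Y pq.1 -> pq.1 <> pq.2 -> ~ V pq.1 k pq.2.
  move=> [p q]; have [[Yp /(Vsep _ _ Yp)[k Vk]]|nYp] := pselect (Y p /\ p <> q).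
    by exists k.
  by exists k0 => Yp npq; case: nYp.
have [R woR] := well_ordering_principle (set_type Y).
rewrite -(card_le_eql (card_setT Y)).
apply: (@erdos_rado _ R (K * K)%type
  (fun p q => (s (val p, val q), s (val q, val p)))) => //.
  exact: pow_le_continuumX.
move=> H [i j] hom.
have -> : countable H = countable [set val p | p in H].
  by rewrite /countable (card_le_eql (inj_card_eq (in2W val_inj))).
apply: contrapT => nctbl; apply: sX; exists [set val p | p in H]; split=> //.
apply/discrete_subspaceP => _ [p Hp <-].
have Yp := set_valP p; exists (V (val p) i `&` V (val p) j).
have [oi Vi] := Vnbhs _ i Yp; have [oj Vj] := Vnbhs _ j Yp.
split=> //; first exact: openI.
move=> _ [q Hq <-] [Viq Vjq]; apply: contrapT => nqp.
have npq : val p <> val q by move=> /esym.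
have [//|lt|lt] := wo_ltgt woR (_ : p <> q).
- by move=> pq; apply: npq; rewrite pq.
- have [eqi _] := hom _ _ Hp Hq lt.
  by have := sP (val p, val q) Yp npq; rewrite /= eqi.
- have [_ eqj] := hom _ _ Hq Hp lt.
  by have := sP (val p, val q) Yp npq; rewrite /= eqj.
Qed.

(** * Disjoint open sets in infinite Hausdorff spaces *)

(** An infinite open set O contains disjoint open sets, one nonempty and the
    other infinite: separate two points of O by U and V; if V is infinite in
    O, take U and V, and if V is finite in O, it is also closed, so take V and
    O minus V. Splitting the infinite part again and again gives the
    sequence. *)
Lemma infinite_hausdorff_cellular (X : topologicalType) :
  infinite_set [set: X] -> hausdorff_space X ->
  exists U : nat -> set X, [/\ forall n, open (U n), forall n, U n !=set0 &
    forall m n, m < n -> U m `&` U n = set0].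
Proof.
move=> infX hX.
have /choice[f fP] : forall O : set X, exists P : set X * set X,
    open O -> infinite_set O ->
    [/\ open P.1 /\ open P.2, P.1 !=set0, infinite_set P.2,
      P.1 `<=` O /\ P.2 `<=` O & P.1 `&` P.2 = set0].
  move=> O.
  have [[oO infO]|nO] := pselect (open O /\ infinite_set O); last first.
    by exists (set0, set0) => oO infO; case: nO.
  have [x Ox] := infinite_setN0 infO.
  have [y [Oy nyx]] : (O `\` [set x]) !=set0.
    apply: infinite_setN0; exact: infinite_setD.
  have [U [V [oU oV Ux Vy UV]]] := hausdorff_separate hX (nesym nyx).
  have [finVO|infVO] := pselect (finite_set (V `&` O)).
    exists (V `&` O, O `\` (V `&` O)) => _ _; split=> /=.
    - split; first exact: openI.
      rewrite setDE; apply: openI => //; apply: closed_openC.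
      exact: (accessible_finite_set_closed.1 (hausdorff_accessible hX)).
    - by exists y.
    - exact: infinite_setD.
    - by split=> z [].
    - exact: setDIK.
  exists (U `&` O, V `&` O) => _ _; split=> //=.
  - by split; exact: openI.
  - by exists x.
  - by rewrite -setIIl UV set0I.
pose O n := iter n (fun O => (f O).2) [set: X].
have OP n : open (O n) /\ infinite_set (O n).
  elim: n => [|n [oO iO]]; first by split=> //; exact: openT.
  by have [[_ ?] _ ? _ _] := fP _ oO iO.
have P n := fP _ (OP n).1 (OP n).2.
have Osub m n : m <= n -> O n `<=` O m.
  move=> /subnK <-; elim: (n - m) => // k IH.
  by apply: subset_trans IH; have [_ _ _ [_ ?] _] := P (k + m).
exists (fun n => (f (O n)).1); split=> [n|n|m n ltmn].
- by have [[]] := P n.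
- by have [_ ?] := P n.
- have [_ _ _ _ PI] := P m; have [_ _ _ [Pn _] _] := P n.
  by apply: subsetI_eq0 PI => // z /Pn; exact: (Osub m.+1).
Qed.

Lemma continuum_le_open (X : topologicalType) :
  infinite_set [set: X] -> hausdorff_space X ->
  continuum #<= [set U : set X | open U].
Proof.
move=> infX hX; have [U [oU U0 UI]] := infinite_hausdorff_cellular infX hX.
pose F (S : set nat) := \bigcup_(n in S) U n.
have disj m n x : U m x -> U n x -> m = n.
  move=> Um Un; case: (ltngtP m n) => // lt.
    by have : (U m `&` U n) x by []; rewrite UI.
  by have : (U n `&` U m) x by []; rewrite UI.
have FI : injective F.
  suff sub S S' : F S = F S' -> S `<=` S'.
    by move=> S S' eqF; apply/seteqP; split; apply: sub.
  move=> eqF n Sn; have [x Ux] := U0 n.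
  have : F S x by exists n.
  by rewrite eqF => -[m S'm Umx]; rewrite (disj n m x).
rewrite -(card_le_eql (inj_card_eq (in2W FI : {in continuum &, injective F}))).
apply: subset_card_le => _ [S _ <-]; exact: bigcup_open.
Qed.

(** * Spaces of countable spread under the separation hypothesis *)

Section CountableSpread.
Hypothesis sep_uncountable_discrete : forall X : topologicalType,
  hausdorff_space X -> [set: X] #= continuum -> strongly_separated X ->
  has_uncountable_discrete_subspace X.
Variables (X : topologicalType) (R : rel (set nat)).
Hypotheses (hX : hausdorff_space X) (sX : countable_spread X).
Hypothesis woR : well_order R.

(** The topology induced by [g] on the continuum itself is a strongly separated
    copy of the range of [g], with [R] as the separating order. *)
Lemma no_strongly_separated_sequence (g : set nat -> X) (W : set nat -> set X) :
  (forall a, closed (W a) /\ nbhs (g a) (W a)) ->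
  (forall a b, wo_lt R b a -> ~ W a (g b)) \/
  (forall a b, wo_lt R a b -> ~ W a (g b)) -> False.
Proof.
move=> Wnbhs Wsep; have Wg a : W a (g a).
  by have [_ /nbhs_singleton] := Wnbhs a.
have gI : injective g.
  move=> a b gab; apply: contrapT => /(wo_ltgt woR) ltab.
  by case: Wsep ltab => Wsep [] /Wsep; rewrite (gab, esym gab); apply.
pose Y : topologicalType := initial_topology g.
pose gY : Y -> X := g.
have gc : continuous gY by exact: initial_continuous.
apply: sX; have [|||D [dD nD]] := @sep_uncountable_discrete Y.
- rewrite open_hausdorff => a b /eqP nab.
  have [|U [V [oU oV Ua Vb UV]]] := @hausdorff_separate X (g a) (g b) hX.
    by move/gI.
  exists (gY @^-1` U, gY @^-1` V); first by split; rewrite inE.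
  split; [exact: open_comp|exact: open_comp|].
  by rewrite -preimage_setI UV preimage_set0.
- exact: card_eqxx.
- have Wpre (a : Y) : closed (gY @^-1` W a) /\ nbhs a (gY @^-1` W a).
    have [cW nW] := Wnbhs a; split; first exact: preimage_closed.
    exact: gc.
  case: Wsep => Wsep; [left|right]; exists R => // a; exists (gY @^-1` W a);
      have [cW nW] := Wpre a; split=> // b ab nab; apply: Wsep;
      by rewrite /wo_lt ab; apply/eqP.
exists (g @` D); split; last first.
  by rewrite /countable (card_le_eql (inj_card_eq (in2W gI))).
apply/discrete_subspaceP => _ [a Da <-].
have [_ [[U oU <-] Ua UD]] := (discrete_subspaceP D).1 dD a Da.
by exists U; split=> // _ [b Db <-] /(UD _ Db) ->.
Qed.

(** Otherwise points of Y could be chosen along the continuum outside the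
    neighbourhoods of the earlier ones, a strongly right separated sequence. *)
Lemma small_cover (x0 : X) (Y : set X) (W : X -> set X) :
  (forall y, Y y -> closed (W y) /\ nbhs y (W y)) ->
  exists a, exists h : segment R a -> X, forall y, Y y -> exists b, W (h b) y.
Proof.
move=> WP; have [[g gP]|[a [h hP]]] := transfinite_selection x0
    (fun A y => Y y /\ forall z, A z -> ~ W z y) woR.
  exfalso; apply: (@no_strongly_separated_sequence g (W \o g)).
    by move=> a; have [Yga _] := gP a; exact: WP.
  right=> a b ltab; have [_] := gP b; apply.
  by exists (exist (fun c => wo_lt R c b) a ltab).
exists a, h => y Yy; apply: contrapT => nW.
apply: (hP y); split=> // _ [b _ <-].
by move=> Why; apply: nW; exists b.
Qed.

(** Otherwise points could be chosen along the continuum outside the closures of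
    the earlier ones; by regularity this sequence is strongly left separated. *)
Lemma small_dense (x0 : X) : regular_space X ->
  exists a, exists h : segment R a -> X, forall y, closure (range h) y.
Proof.
move=> rX; have [[g gP]|[a [h hP]]] := transfinite_selection x0
    (fun A y => ~ closure A y) woR; last first.
  by exists a, h => y; apply: contrapT; exact: hP.
exfalso; have /choice[W WP] : forall a, exists W, [/\ closed W, nbhs (g a) W &
    W `<=` ~` closure (range (fun b : segment R a => g (val b)))].
  move=> a; apply: regular_closed_nbhs (gP a) => //.
  by apply: closed_openC; exact: closed_closure.
apply: (@no_strongly_separated_sequence g W) => [a|]; first by case: (WP a).
left=> a b ltba Wgb; have [_ _ /(_ _ Wgb)] := WP a; apply.
by apply: subset_closure; exists (exist (fun c => wo_lt R c a) b ltba).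
Qed.

Hypothesis segR : forall a, pow_le_continuum (segment R a).

(** The sets V k are the complements of the members of a small cover of the
    complement of p by closed sets missing p. *)
Lemma small_pseudocharacter (p : X) :
  exists a, exists V : segment R a -> set X,
    (forall k, open (V k) /\ V k p) /\ (forall q, p <> q -> exists k, ~ V k q).
Proof.
have /choice[W WP] : forall y, exists W, [/\ closed W, ~ W p &
    y <> p -> nbhs y W].
  move=> y; have [->|nyp] := pselect (y = p).
    (* The cover may use the index p, so W p also has to miss p. *)
    by exists set0; split=> //; exact: closed0.
  have [U [V [oU oV Uy Vp UV]]] := hausdorff_separate hX nyp.
  exists (closure U); split; first exact: closed_closure.
    move=> /(_ V (open_nbhs_nbhs (conj oV Vp))); rewrite UV => -[? []].
  move=> _; apply: filterS (@subset_closure _ U) _.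
  exact: open_nbhs_nbhs.
have [|a [h hP]] := small_cover p (Y := ~` [set p]) (W := W).
  by move=> y nyp; have [cW _ nW] := WP y; split=> //; exact: nW.
exists a, (fun k => ~` W (h k)); split=> [k|q /nesym /hP[k Wk]].
  by have [cW Wp _] := WP (h k); split=> //; exact: closed_openC.
by exists k => /(_ Wk).
Qed.

Lemma card_le_continuum_of_spread : [set: X] #<= continuum.
Proof.
have /choice[a aP] := small_pseudocharacter.
have -> : [set: X] = \bigcup_b [set p | a p = b].
  by apply/seteqP; split=> // p _; exists (a p).
apply: card_bigcup_le_continuum => b.
have /choice[V VP] : forall p, exists V : segment R b -> set X, a p = b ->
    (forall k, open (V k) /\ V k p) /\ (forall q, p <> q -> exists k, ~ V k q).
  move=> p; have [<-|nb] := pselect (a p = b).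
    by have [V ?] := aP p; exists V.
  by exists (fun=> setT) => /nb.
apply: (@card_le_of_pseudocharacter _ _ _ V (segR b)) => // p.
  by move=> k /VP[].
by move=> q /VP[_]; exact.
Qed.

(** The sets B S generate every open set from the traces of a small dense set,
    and each open set is a union of the B S over a single segment. *)
Lemma open_le_continuum : infinite_set [set: X] -> regular_space X ->
  [set U : set X | open U] #<= continuum.
Proof.
move=> /infinite_setN0[x0 _] rX.
have [a [d dd]] := small_dense x0 rX.
pose B S := (closure (d @` S))°.
pose G b (Q : set (segment R b * segment R a)) :=
  \bigcup_k B [set l | Q (k, l)].
apply: (@card_le_trans _ _ _ (\bigcup_b range (@G b))); last first.
  apply: card_bigcup_le_continuum => b.
  by apply: card_le_trans (card_image_le _ _) _; exact: pow_le_continuumX.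
apply: subset_card_le => U /= oU.
(* Off U the set S y is empty, so that B (S y) lies in U for every y: the
   cover below may use indices outside U. *)
have /choice[S SP] : forall y, exists S, B S `<=` U /\ (U y -> B S y).
  move=> y; have [Uy|nUy] := pselect (U y); last first.
    by exists set0; rewrite /B image_set0 closure0 interior0; split.
  have [S [SU Sy]] := regular_open_trace rX dd oU Uy.
  by exists S; split=> //; apply: subset_trans SU; exact: interior_subset.
have /choice[W WP] : forall y, exists W, U y ->
    [/\ closed W, nbhs y W & W `<=` B (S y)].
  move=> y; have [Uy|nUy] := pselect (U y); last by exists set0 => /nUy.
  have [W ?] := regular_closed_nbhs rX (@open_interior _ (closure (d @` S y)))
    ((SP y).2 Uy).
  by exists W.
have [|b [h hP]] := small_cover x0
  (Y := U) (W := fun y => if pselect (U y) then W y else set0).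
  by move=> y Uy; case: pselect => // ?; have [] := WP y Uy.
exists b => //; exists [set kl | S (h kl.1) kl.2] => //.
apply/seteqP; split=> y; first by case=> k _; exact: (SP (h k)).1.
move=> /hP[k]; case: pselect => // Uhk Wy; exists k => //.
by have [_ _] := WP _ Uhk; apply.
Qed.

End CountableSpread.

Theorem theorem2p5 :
  has_card_two_pow_lt continuum continuum ->
  (forall X : topologicalType,
     hausdorff_space X -> [set: X] #= continuum -> strongly_separated X ->
     has_uncountable_discrete_subspace X) ->
  (forall X : topologicalType,
     hausdorff_space X -> countable_spread X -> [set: X] #<= continuum) /\
  (forall X : topologicalType,
     infinite_set [set: X] -> hausdorff_space X -> regular_space X ->
     countable_spread X -> [set U : set X | open U] #= continuum).
Proof.
move=> [pow_lt _] sep; have [R woR segR] := initial_well_order_continuum.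
have powR a : pow_le_continuum (segment R a) by exact: pow_lt.
split=> [X hX sX|X infX hX rX sX].
  exact: (card_le_continuum_of_spread sep hX sX woR powR).
apply: Cantor_Bernstein; last exact: continuum_le_open.
exact: (open_le_continuum sep hX sX woR powR).
Qed.
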